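(* Let $J=\{1,\dots,n\}$, let $x_j\in\mathbb{R}^m$, $y_j\in\mathbb{R}^s$ ($j\in J$) be vectors with strictly positive components, and let $DMU_o=(x_o,y_o)$, $o\in J$, be $FDH_V$-efficient. Define, for $j\in J$, $$\alpha_{jo}:=\max_{1\le i\le m}\frac{x_{ij}}{x_{io}},\qquad \beta_{jo}:=\min_{1\le r\le s}\frac{y_{rj}}{y_{ro}}.$$ Then: (i) Left-IRS prevails at $DMU_o$ if and only if for each $j\in J$, $\alpha_{jo}\ge1$ or $\beta_{jo}<\alpha_{jo}$. (ii) Left-DRS prevails at $DMU_o$ if and only if there exists some $j\in J$ such that $\alpha_{jo}<1$ and $\alpha_{jo}<\beta_{jo}$. (iii) Left-CRS prevails at $DMU_o$ if and only if both of the following hold: (iii-a) for some $j\in J$, $\alpha_{jo}<1$ and $\beta_{jo}\ge\alpha_{jo}$; (iii-b) for each $j\in J$, $\alpha_{jo}\ge1$ or $\alpha_{jo}\ge\beta_{jo}$.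
   Context: There are $n$ decision making units $DMU_j=(x_j,y_j)$, $j\in J$, with strictly positive input vectors $x_j=(x_{1j},\dots,x_{mj})^t$ and output vectors $y_j=(y_{1j},\dots,y_{sj})^t$. Vector inequalities are componentwise. The technology is $$T^{FDH_V}=\Big\{(x,y)\in\mathbb{R}^m\times\mathbb{R}^s:\ \exists\,\lambda\in\{0,1\}^n,\ \sum_{j}\lambda_j=1,\ \sum_j\lambda_jx_j\le x,\ \sum_j\lambda_jy_j\ge y\ge0\Big\}.$$ $DMU_o$ is $FDH_V$-efficient if there is no $(x,y)\in T^{FDH_V}$ with $x\le x_o$, $y\ge y_o$, $(x,y)\neq(x_o,y_o)$. $\operatorname{int}A$ and $A^c$ denote the interior and the complement of a set $A$ (in $\mathbb{R}^{m+s}$), and $z_\delta:=(\delta x_o,\delta y_o)$. One-sided returns to scale on the left, for an $FDH_V$-efficient $DMU_o$: Left-IRS prevails if $z_\delta\in(T^{FDH_V})^c$ for each $0<\delta<1$; Left-DRS prevails if $z_\delta\in\operatorname{int}T^{FDH_V}$ for some $0<\delta<1$; Left-CRS prevails if neither Left-IRS nor Left-DRS prevails. *)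

(* Defs.v *)
From HB Require Import structures.
From mathcomp Require Import all_boot all_order all_algebra.
From mathcomp Require Import all_classical all_reals all_analysis.

Set Implicit Arguments.
Unset Strict Implicit.
Unset Printing Implicit Defensive.

Import Order.TTheory GRing.Theory Num.Theory.
Import numFieldNormedType.Exports.

Local Open Scope classical_set_scope.
Local Open Scope ring_scope.

Definition cvle (R : realType) (k : nat) (u v : 'cV[R]_k) : Prop :=
  forall i, u i 0 <= v i 0.

Definition cvpos (R : realType) (k : nat) (u : 'cV[R]_k) : Prop :=
  forall i, 0 < u i 0.

(* [R^m x R^s] carries the product topology, which is the usual one of
   R^(m+s). *)
Definition FDHV (R : realType) (n m s : nat)
    (x : 'I_n -> 'cV[R]_m) (y : 'I_n -> 'cV[R]_s) :
    set ('cV[R]_m * 'cV[R]_s) :=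
  [set z | exists lambda : 'I_n -> R,
     [/\ forall j, lambda j = 0 \/ lambda j = 1,
         \sum_j lambda j = 1,
         cvle (\sum_j lambda j *: x j) z.1,
         cvle z.2 (\sum_j lambda j *: y j)
       & cvle 0 z.2]].

Definition FDHV_efficient (R : realType) (n m s : nat)
    (x : 'I_n -> 'cV[R]_m) (y : 'I_n -> 'cV[R]_s) (o : 'I_n) : Prop :=
  ~ exists z, [/\ FDHV x y z, cvle z.1 (x o), cvle (y o) z.2
                & z <> (x o, y o)].

Definition zdelta (R : realType) (n m s : nat)
    (x : 'I_n -> 'cV[R]_m) (y : 'I_n -> 'cV[R]_s) (o : 'I_n) (delta : R) :
    'cV[R]_m * 'cV[R]_s :=
  (delta *: x o, delta *: y o).

Definition left_IRS (R : realType) (n m s : nat)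
    (x : 'I_n -> 'cV[R]_m) (y : 'I_n -> 'cV[R]_s) (o : 'I_n) : Prop :=
  forall delta : R, 0 < delta < 1 -> (~` FDHV x y) (zdelta x y o delta).

Definition left_DRS (R : realType) (n m s : nat)
    (x : 'I_n -> 'cV[R]_m) (y : 'I_n -> 'cV[R]_s) (o : 'I_n) : Prop :=
  exists delta : R, 0 < delta < 1 /\ (FDHV x y)° (zdelta x y o delta).

Definition left_CRS (R : realType) (n m s : nat)
    (x : 'I_n -> 'cV[R]_m) (y : 'I_n -> 'cV[R]_s) (o : 'I_n) : Prop :=
  ~ left_IRS x y o /\ ~ left_DRS x y o.

(* The maximum and the minimum below range over a nonempty index set; the
   initial value of the iteration is one of the terms, so it does not affect
   the result. *)
Definition alpha (R : realType) (n m : nat) (x : 'I_n -> 'cV[R]_m.+1)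
    (o j : 'I_n) : R :=
  \big[Num.max/x j ord0 0 / x o ord0 0]_(i < m.+1) (x j i 0 / x o i 0).

Definition beta (R : realType) (n s : nat) (y : 'I_n -> 'cV[R]_s.+1)
    (o j : 'I_n) : R :=
  \big[Num.min/y j ord0 0 / y o ord0 0]_(r < s.+1) (y j r 0 / y o r 0).

(* Main.v *)
Require Import Defs.
From HB Require Import structures.
From mathcomp Require Import all_boot all_order all_algebra.
From mathcomp Require Import all_classical all_reals all_analysis.
From mathcomp Require Import lra.

Set Implicit Arguments.
Unset Strict Implicit.
Unset Printing Implicit Defensive.

Import Order.TTheory GRing.Theory Num.Theory.
Import numFieldNormedType.Exports.

Local Open Scope classical_set_scope.
Local Open Scope ring_scope.

(** The selection vector [lambda] of the technology is a unit vector, so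
    [FDHV x y] is the union over the units [j] of the sets
    [{(u, v) | x j <= u, 0 <= v <= y j}].  On the ray through unit [o] this
    becomes a one-dimensional condition: [x j <= delta *: x o] says that
    [alpha x o j <= delta], and [delta *: y o <= y j] says that
    [delta <= beta x o j].  Hence the point of parameter [delta > 0] lies in the
    technology iff [delta] lies in one of the intervals
    [[alpha x o j, beta y o j]] ([zdelta_FDHV]), and in its interior iff
    [delta] lies in the interior of one of them ([zdelta_interior_FDHV]).  The
    second equivalence is not immediate for a union of closed sets: a point
    could be interior to the union and to no member.  Here it holds because
    interiority allows the inputs to be decreased and the outputs to be
    increased at the same time, and the single unit that dominates the perturbed
    point dominates the original one strictly.

    Left-IRS then says that no interval meets the open interval from 0 to 1,
    and Left-DRS that the interior of some interval meets it.  As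
    [alpha x o j > 0], an interval with [alpha x o j < 1] that is nonempty meets
    it at [alpha x o j] itself, and one with nonempty interior meets it just
    above [alpha x o j].  The case of Left-CRS is the conjunction of the two
    negations. *)

(** * Ratios as one-dimensional tests *)

Lemma alpha_leP (R : realType) (n m : nat) (x : 'I_n -> 'cV[R]_m.+1)
    (o j : 'I_n) (c : R) : cvpos (x o) ->
  alpha x o j <= c <-> cvle (x j) (c *: x o).
Proof.
move=> xo_pos; split.
  by move=> /bigmax_leP[_ le_c] i; rewrite mxE -ler_pdivrMr//; exact: le_c.
move=> le_c; have le_ratio i : x j i 0 / x o i 0 <= c.
  by rewrite ler_pdivrMr//; have := le_c i; rewrite mxE.
by apply/bigmax_leP; split.
Qed.

Lemma alpha_ltP (R : realType) (n m : nat) (x : 'I_n -> 'cV[R]_m.+1)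
    (o j : 'I_n) (c : R) : cvpos (x o) ->
  alpha x o j < c <-> forall i, x j i 0 < (c *: x o) i 0.
Proof.
move=> xo_pos; split.
  by move=> /bigmax_ltP[_ lt_c] i; rewrite mxE -ltr_pdivrMr//; exact: lt_c.
move=> lt_c; have lt_ratio i : x j i 0 / x o i 0 < c.
  by rewrite ltr_pdivrMr//; have := lt_c i; rewrite mxE.
by apply/bigmax_ltP; split.
Qed.

Lemma beta_geP (R : realType) (n s : nat) (y : 'I_n -> 'cV[R]_s.+1)
    (o j : 'I_n) (c : R) : cvpos (y o) ->
  c <= beta y o j <-> cvle (c *: y o) (y j).
Proof.
move=> yo_pos; split.
  by move=> /bigmin_geP[_ ge_c] i; rewrite mxE -ler_pdivlMr//; exact: ge_c.
move=> ge_c; have ge_ratio i : c <= y j i 0 / y o i 0.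
  by rewrite ler_pdivlMr//; have := ge_c i; rewrite mxE.
by apply/bigmin_geP; split.
Qed.

Lemma beta_gtP (R : realType) (n s : nat) (y : 'I_n -> 'cV[R]_s.+1)
    (o j : 'I_n) (c : R) : cvpos (y o) ->
  c < beta y o j <-> forall r, (c *: y o) r 0 < y j r 0.
Proof.
move=> yo_pos; split.
  by move=> /bigmin_gtP[_ gt_c] i; rewrite mxE -ltr_pdivlMr//; exact: gt_c.
move=> gt_c; have gt_ratio i : c < y j i 0 / y o i 0.
  by rewrite ltr_pdivlMr//; have := gt_c i; rewrite mxE.
by apply/bigmin_gtP; split.
Qed.

Lemma alpha_gt0 (R : realType) (n m : nat) (x : 'I_n -> 'cV[R]_m.+1)
    (o j : 'I_n) : cvpos (x o) -> cvpos (x j) -> 0 < alpha x o j.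
Proof.
move=> xo_pos xj_pos.
have /alpha_leP -/(_ xo_pos ord0) := lexx (alpha x o j).
rewrite mxE => /(lt_le_trans (xj_pos ord0)).
by rewrite pmulr_lgt0.
Qed.

(** * The technology as a union over single units *)

Lemma sum_delta_scale (R : realType) (n k : nat) (v : 'I_n -> 'cV[R]_k)
    (j : 'I_n) : \sum_i ((i == j)%:R : R) *: v i = v j.
Proof.
rewrite (bigD1 j)//= eqxx scale1r big1 ?addr0// => i /negPf ->.
by rewrite scale0r.
Qed.

(** A 0-1 vector of sum 1 has an entry equal to 1, since the sum is nonzero;
    the other entries are nonnegative and sum to 0. *)
Lemma zero_one_sum1 (R : realType) (n : nat) (lambda : 'I_n -> R) :
  (forall j, lambda j = 0 \/ lambda j = 1) -> \sum_j lambda j = 1 ->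
  exists j, forall i, lambda i = (i == j)%:R.
Proof.
move=> lambda01 sum1.
have [j lambdaj] : exists j, lambda j = 1.
  apply: contrapT => no1; have /eqP := sum1.
  rewrite big1 => [|i _]; first by rewrite eq_sym oner_eq0.
  by case: (lambda01 i) => // lambdai; case: no1; exists i.
exists j => i; have [->//|neq_ij] := eqVneq i j.
have rest0 : \sum_(k | k != j) lambda k = 0.
  by move: sum1; rewrite (bigD1 j)//= lambdaj => sum1; lra.
apply: (psumr_eq0P _ rest0) => // k _.
by case: (lambda01 k) => ->.
Qed.

Lemma FDHV_dominated (R : realType) (n m s : nat)
    (x : 'I_n -> 'cV[R]_m) (y : 'I_n -> 'cV[R]_s) (z : 'cV[R]_m * 'cV[R]_s) :
  FDHV x y z <-> exists j, [/\ cvle (x j) z.1, cvle z.2 (y j) & cvle 0 z.2].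
Proof.
split=> [[lambda [lambda01 sum1 xle yge z0]]|[j [xle yge z0]]].
  have [j lambdaE] := zero_one_sum1 lambda01 sum1; exists j.
  move: xle yge; under eq_bigr do rewrite lambdaE; rewrite sum_delta_scale.
  by under eq_bigr do rewrite lambdaE; rewrite sum_delta_scale.
exists (fun i => (i == j)%:R); split=> //; rewrite ?sum_delta_scale//.
  by move=> i; case: eqP; [right|left].
rewrite (bigD1 j)//= eqxx big1 ?addr0// => i /negPf ->//.
Qed.

(** * The ray through a unit *)

(** Inputs and outputs are scaled by separate factors [a] and [b], so that the
    lemma also applies to perturbations of a point of the ray. *)
Lemma FDHV_scaled (R : realType) (n m s : nat)
    (x : 'I_n -> 'cV[R]_m.+1) (y : 'I_n -> 'cV[R]_s.+1) (o : 'I_n) (a b : R) :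
  cvpos (x o) -> cvpos (y o) -> 0 <= b ->
  FDHV x y (a *: x o, b *: y o) <->
  exists j, alpha x o j <= a /\ b <= beta y o j.
Proof.
move=> xo_pos yo_pos b_ge0; rewrite FDHV_dominated; split=> -[j].
  by case=> xle yge _; exists j; split; [apply/alpha_leP|apply/beta_geP].
case=> alpha_le beta_ge; exists j; split; [exact/alpha_leP|exact/beta_geP|].
by move=> r; rewrite !mxE mulr_ge0// ltW.
Qed.

Lemma zdelta_FDHV (R : realType) (n m s : nat)
    (x : 'I_n -> 'cV[R]_m.+1) (y : 'I_n -> 'cV[R]_s.+1) (o : 'I_n) (d : R) :
  cvpos (x o) -> cvpos (y o) -> 0 <= d ->
  FDHV x y (zdelta x y o d) <-> exists j, alpha x o j <= d <= beta y o j.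
Proof.
move=> xo_pos yo_pos d_ge0; rewrite FDHV_scaled//.
by split=> -[j] => [[le1 le2]|/andP[le1 le2]]; exists j; rewrite ?le1.
Qed.

Lemma near_cv_gt (R : realType) (k : nat) (u v : 'cV[R]_k) :
  (forall i, u i 0 < v i 0) -> nbhs v [set w | forall i, u i 0 < w i 0].
Proof.
move=> lt_uv; have near_i i : nbhs v [set w : 'cV[R]_k | u i 0 < w i 0].
  exact: (cvgr_gt _ (@coord_continuous R k 1 i 0 v) _ (lt_uv i)).
exact: (filter_forall (nbhs_filter v) near_i).
Qed.

Lemma near_cv_lt (R : realType) (k : nat) (u v : 'cV[R]_k) :
  (forall i, v i 0 < u i 0) -> nbhs v [set w | forall i, w i 0 < u i 0].
Proof.
move=> lt_vu; have near_i i : nbhs v [set w : 'cV[R]_k | w i 0 < u i 0].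
  exact: (cvgr_lt _ (@coord_continuous R k 1 i 0 v) _ (lt_vu i)).
exact: (filter_forall (nbhs_filter v) near_i).
Qed.

(** A point of the interior stays in the technology when its inputs are scaled
    down and its outputs scaled up by a small [e]; the unit dominating the new
    point has [alpha x o j <= d - e] and [d + e <= beta y o j].  Conversely, a
    unit that dominates the point strictly in every coordinate still dominates
    all neighbouring points, whose outputs remain positive. *)
Lemma zdelta_interior_FDHV (R : realType) (n m s : nat)
    (x : 'I_n -> 'cV[R]_m.+1) (y : 'I_n -> 'cV[R]_s.+1) (o : 'I_n) (d : R) :
  cvpos (x o) -> cvpos (y o) -> 0 < d ->
  (FDHV x y)° (zdelta x y o d) <-> exists j, alpha x o j < d < beta y o j.
Proof.
move=> xo_pos yo_pos d_gt0; split=> [int_d|[j /andP[alpha_lt beta_gt]]].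
  have cont : (fun e : R => ((d - e) *: x o, (d + e) *: y o)) @ 0 -->
      zdelta x y o d.
    have cont_x : (d - e) *: x o @[e --> 0] --> d *: x o.
      apply: cvgZr_tmp; rewrite -[X in _ --> X]subr0.
      by apply: cvgB; [exact: cvg_cst|exact: cvg_id].
    have cont_y : (d + e) *: y o @[e --> 0] --> d *: y o.
      apply: cvgZr_tmp; rewrite -[X in _ --> X]addr0.
      by apply: cvgD; [exact: cvg_cst|exact: cvg_id].
    exact: (cvg_pair cont_x cont_y).
  have /nbhs_ballP[r /= r_gt0 in_FDHV] := cont _ int_d.
  have r2_gt0 : 0 < r / 2 by rewrite divr_gt0.
  have : FDHV x y ((d - r / 2) *: x o, (d + r / 2) *: y o).
    apply: in_FDHV; rewrite /ball/= sub0r normrN gtr0_norm//; lra.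
  rewrite FDHV_scaled//; last lra.
  by case=> j [alpha_le beta_ge]; exists j; apply/andP; split; lra.
have near1 := near_cv_gt ((alpha_ltP j d xo_pos).1 alpha_lt).
have near2 := near_cv_lt ((beta_gtP j d yo_pos).1 beta_gt).
have dyo_pos i : (0 : 'cV[R]_s.+1) i 0 < (d *: y o) i 0.
  by rewrite !mxE mulr_gt0.
have near3 := near_cv_gt dyo_pos.
exists ([set u : 'cV[R]_m.+1 | forall i, x j i 0 < u i 0],
        [set v : 'cV[R]_s.+1 | (forall i, v i 0 < y j i 0) /\
                 forall i, (0 : 'cV[R]_s.+1) i 0 < v i 0]).
  by split=> //; exact: filterI.
case=> u v [/= xlt [ylt v_gt0]]; apply/FDHV_dominated.
by exists j; split=> i /=; apply: ltW.
Qed.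

(** * Left returns to scale *)

(** At an interval that violates the right-hand side, the witness against
    Left-IRS is its left end, [alpha x o j]. *)
Lemma left_IRS_iff (R : realType) (n m s : nat)
    (x : 'I_n -> 'cV[R]_m.+1) (y : 'I_n -> 'cV[R]_s.+1) (o : 'I_n) :
  (forall j, cvpos (x j)) -> cvpos (y o) ->
  left_IRS x y o <-> forall j, 1 <= alpha x o j \/ beta y o j < alpha x o j.
Proof.
move=> x_pos yo_pos; split=> [irs j|no_meet d /andP[d_gt0 d_lt1]].
  have [|alpha_lt1] := leP 1 (alpha x o j); first by left.
  have [|beta_ge] := ltP (beta y o j) (alpha x o j); first by right.
  have alpha_pos : 0 < alpha x o j by exact: alpha_gt0.
  have := irs (alpha x o j); rewrite alpha_pos alpha_lt1 => /(_ isT)[].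
  by apply/zdelta_FDHV => //; [exact: ltW|exists j; rewrite lexx].
rewrite /setC/= zdelta_FDHV//; last exact: ltW.
by case=> j /andP[alpha_le beta_ge]; case: (no_meet j) => ?; lra.
Qed.

Lemma left_DRS_iff (R : realType) (n m s : nat)
    (x : 'I_n -> 'cV[R]_m.+1) (y : 'I_n -> 'cV[R]_s.+1) (o : 'I_n) :
  (forall j, cvpos (x j)) -> cvpos (y o) ->
  left_DRS x y o <-> exists j, alpha x o j < 1 /\ alpha x o j < beta y o j.
Proof.
move=> x_pos yo_pos; split=> [[d [/andP[d_gt0 d_lt1]]]|].
  rewrite zdelta_interior_FDHV// => -[j /andP[alpha_lt beta_gt]].
  by exists j; split; lra.
case=> j [alpha_lt1 alpha_ltb].
have alpha_pos : 0 < alpha x o j by exact: alpha_gt0.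
have : alpha x o j < Num.min 1 (beta y o j) by rewrite lt_min alpha_lt1.
move=> /midf_lt[]; set d := (_ / 2) => alpha_ltd.
rewrite lt_min => /andP[d_lt1 d_ltb].
have d_gt0 : 0 < d by exact: lt_trans alpha_ltd.
exists d; split; first by rewrite d_gt0.
by apply/zdelta_interior_FDHV => //; exists j; rewrite alpha_ltd.
Qed.

Theorem theorem5 (R : realType) (n m s : nat)
    (x : 'I_n -> 'cV[R]_m.+1) (y : 'I_n -> 'cV[R]_s.+1) (o : 'I_n)
    (x_pos : forall j, cvpos (x j)) (y_pos : forall j, cvpos (y j))
    (o_eff : FDHV_efficient x y o) :
  [/\ left_IRS x y o <->
        (forall j, 1 <= alpha x o j \/ beta y o j < alpha x o j),
      left_DRS x y o <->
        (exists j, alpha x o j < 1 /\ alpha x o j < beta y o j)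
    & left_CRS x y o <->
        (exists j, alpha x o j < 1 /\ alpha x o j <= beta y o j) /\
        (forall j, 1 <= alpha x o j \/ beta y o j <= alpha x o j)].
Proof.
have irs := left_IRS_iff x_pos (y_pos o).
have drs := left_DRS_iff x_pos (y_pos o).
split=> //; rewrite /left_CRS irs drs; split=> [[not_irs not_drs]|].
  split=> [|j].
    move/existsNP: not_irs => [j /not_orP[/negP alpha_lt /negP beta_ge]].
    by exists j; rewrite ltNge alpha_lt leNgt beta_ge.
  have [|alpha_lt1] := leP 1 (alpha x o j); first by left.
  have [|beta_gt] := leP (beta y o j) (alpha x o j); first by right.
  by case: not_drs; exists j.
case=> -[j [alpha_lt1 beta_ge]] no_int; split.
  by move=> /(_ j)[?|?]; lra.
by case=> k [alpha_lt1' beta_gt]; case: (no_int k) => ?; lra.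
Qed.
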